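(* Let $\alpha=0$, $\beta\in(0,\infty)$, $\nu\in(0,2]$, $\eta\in(0,\infty)$. The critical subset $S_1=\{\boldsymbol z\in\mathcal M_4:\operatorname{rank}d\Phi(\boldsymbol z)=1\}$ of the integral map $\Phi=(\mathcal F_2,\mathcal E):\mathcal M_4\to\mathbb R^2$ is the union of two subsets, $S_1=S_1^\alpha\cup S_1^0$, where, with $\boldsymbol\gamma(\vartheta,\varphi)=(\sin\vartheta\sin\varphi,\sin\vartheta\cos\varphi,\cos\vartheta)$, $$S_1^0=\Big\{(\boldsymbol\omega,\boldsymbol\gamma(\vartheta,\varphi))\ :\ \boldsymbol\omega=(0,0,\omega_3),\ \vartheta=\tfrac{\pi}{2},\ \varphi\in[0,2\pi),\ \omega_3\in\mathbb R\Big\},$$ and $$S_1^\alpha=\Big\{(\boldsymbol\omega,\boldsymbol\gamma(\vartheta,\varphi))\ :\ \boldsymbol\omega=\omega_0(\vartheta)\,\frac{\boldsymbol\gamma\times(\boldsymbol e_3\times\boldsymbol\gamma)}{|\boldsymbol e_3\times\boldsymbol\gamma|},\ \varphi\in[0,2\pi)\Big\},$$ where $\omega_0(\vartheta)$ is either of the two real square roots of $$\omega_0^2=\frac{-\eta\sin^2\vartheta\,\big((1-\beta^2)\cos\vartheta+\alpha Z(\vartheta)\big)}{\cos\vartheta\, Z(\vartheta)\,\big(\eta(Z(\vartheta)+\alpha\cos\vartheta)^2+\cos^2\vartheta+\nu\sin^2\vartheta\big)}\Bigg|_{\alpha=0},\qquad Z(\vartheta)=\sqrt{\beta^2\sin^2\vartheta+\cos^2\vartheta},$$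 and $\vartheta$ ranges over the values in $(0,\pi)\setminus\{\pi/2\}$ for which the right-hand side of the expression for $\omega_0^2$ is nonnegative.
   Context: Setting: a dynamically symmetric ellipsoid of revolution rolls on a horizontal plane without slipping and without spinning about the vertical. Units are dimensionless: mass unit is the body's mass $m$, length unit is the semiaxis $b_3$ along the symmetry axis, time unit is $\sqrt{b_3/\mathrm g}$. Parameters: $\alpha=a/b_3\in[0,1]$ (displacement of the center of mass from the geometric center along the symmetry axis), $\beta=b_1/b_3\in(0,\infty)$ ($b_1$ the equatorial semiaxis), $\nu=i_3/i_1\in(0,2]$, $\eta=mb_3^2/i_1\in(0,\infty)$, where $\mathbf I=\operatorname{diag}(i_1,i_1,i_3)$ is the principal central inertia tensor; in dimensionless units $\mathbf I=\operatorname{diag}(1/\eta,1/\eta,\nu/\eta)$. All vectors are written in a body-fixed frame with origin at the center of mass and third basis vector $\boldsymbol e_3$ along the symmetry axis. $\boldsymbol\omega\in\mathbb R^3$ is the angular velocity and $\boldsymbol\gamma\in\mathbb R^3$ the upward vertical unit vector. The vector from the center of mass to the contact point is $$\boldsymbol r(\boldsymbol\gamma)=-\frac{(\beta^2\gamma_1,\beta^2\gamma_2,\gamma_3)}{\sqrt{\beta^2(\gamma_1^2+\gamma_2^2)+\gamma_3^2}}-\alpha\boldsymbol e_3 ,$$ and $\mathbf J=\mathbf I+|\boldsymbol r|^2\mathbf E_3-\boldsymbol r\otimes\boldsymbol r$, where $\mathbf E_3$ is the $3\times 3$ identity matrix. Define on $\{\boldsymbol z=(\boldsymbol\omega,\boldsymbol\gamma)\}$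 the functions $\mathcal F_0=(\boldsymbol\gamma,\boldsymbol\gamma)$, $\mathcal F_1=(\boldsymbol\omega,\boldsymbol\gamma)$, $\mathcal F_2=J(\gamma_3)\,\omega_3$ with $J(\gamma_3)=\sqrt{\tfrac1\eta\big(\gamma_3^2+\nu(1-\gamma_3^2)\big)+(\boldsymbol r,\boldsymbol\gamma)^2}$, and the energy $\mathcal E=\tfrac12(\mathbf J\boldsymbol\omega,\boldsymbol\omega)-(\boldsymbol r,\boldsymbol\gamma)$. These are first integrals of the equations of motion on $\mathcal F_1=0$. The four-dimensional phase space is $\mathcal M_4=\{\boldsymbol z=(\boldsymbol\omega,\boldsymbol\gamma): \mathcal F_0=1,\ \mathcal F_1=0\}$, and the integral map is $\Phi:\mathcal M_4\to\mathbb R^2$, $\Phi(\boldsymbol z)=(\mathcal F_2(\boldsymbol z),\mathcal E(\boldsymbol z))$; $d\Phi$ is its differential on $\mathcal M_4$. *)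

(* Defs.v *)
From HB Require Import structures.
From mathcomp Require Import all_boot all_order all_algebra.
From mathcomp Require Import all_classical all_reals all_analysis.
Set Implicit Arguments.
Unset Strict Implicit.
Unset Printing Implicit Defensive.
Import Order.TTheory GRing.Theory Num.Theory.
Import numFieldNormedType.Exports.
Local Open Scope classical_set_scope.
Local Open Scope ring_scope.

Section Vectors.
Variable R : realType.

Definition row2 (a b : R) : 'rV[R]_2 := \row_(i < 2) [:: a; b]`_i.
Definition row3 (a b c : R) : 'rV[R]_3 := \row_(i < 3) [:: a; b; c]`_i.

Definition dot (u v : 'rV[R]_3) : R := (u *m v^T) 0 0.

(* The library norm `|u| on row vectors is the sup norm, hence a separate
   Euclidean norm. *)
Definition enorm (u : 'rV[R]_3) : R := Num.sqrt (dot u u).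

Definition cross (u v : 'rV[R]_3) : 'rV[R]_3 :=
  row3 (u 0 1 * v 0 2 - u 0 2 * v 0 1)
       (u 0 2 * v 0 0 - u 0 0 * v 0 2)
       (u 0 0 * v 0 1 - u 0 1 * v 0 0).

Definition e3 : 'rV[R]_3 := row3 0 0 1.

End Vectors.

Section Ellipsoid.
Variable R : realType.
Variables alpha beta nu eta : R.

(* A state z = (omega, gamma) in R^6 is the row vector row_mx omega gamma. *)
Definition omega (z : 'rV[R]_(3 + 3)) : 'rV[R]_3 := lsubmx z.
Definition gamma (z : 'rV[R]_(3 + 3)) : 'rV[R]_3 := rsubmx z.

Definition rvec (g : 'rV[R]_3) : 'rV[R]_3 :=
  - ((Num.sqrt (beta ^+ 2 * (g 0 0 ^+ 2 + g 0 1 ^+ 2) + g 0 2 ^+ 2))^-1 *: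
       row3 (beta ^+ 2 * g 0 0) (beta ^+ 2 * g 0 1) (g 0 2))
  - alpha *: e3 R.

Definition inertia : 'M[R]_3 := diag_mx (row3 eta^-1 eta^-1 (nu / eta)).

Definition Jmx (g : 'rV[R]_3) : 'M[R]_3 :=
  inertia + (dot (rvec g) (rvec g))%:M - (rvec g)^T *m rvec g.

Definition F0 (z : 'rV[R]_(3 + 3)) : R := dot (gamma z) (gamma z).

Definition F1 (z : 'rV[R]_(3 + 3)) : R := dot (omega z) (gamma z).

(* For |g| = 1 this depends on g only through its third component. *)
Definition Jfun (g : 'rV[R]_3) : R :=
  Num.sqrt (eta^-1 * (g 0 2 ^+ 2 + nu * (1 - g 0 2 ^+ 2))
            + dot (rvec g) g ^+ 2).

Definition F2 (z : 'rV[R]_(3 + 3)) : R := Jfun (gamma z) * omega z 0 2.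

(* Jmx is symmetric, so it may act on row vectors from the right. *)
Definition energy (z : 'rV[R]_(3 + 3)) : R :=
  2^-1 * dot (omega z *m Jmx (gamma z)) (omega z)
  - dot (rvec (gamma z)) (gamma z).

Definition M4 : set 'rV[R]_(3 + 3) := [set z | F0 z = 1 /\ F1 z = 0].

Definition constraints (z : 'rV[R]_(3 + 3)) : 'rV[R]_2 := row2 (F0 z) (F1 z).

Definition Phi (z : 'rV[R]_(3 + 3)) : 'rV[R]_2 := row2 (F2 z) (energy z).

(* The differentials of F0 and F1 are linearly independent at every point of
   M4, so the tangent space T_z M4 is the kernel of the differential of
   (F0, F1).  It is given here as the row space of a 6 x 6 matrix. *)
Definition tangentM4 (z : 'rV[R]_(3 + 3)) : 'M[R]_(3 + 3) :=
  kermx (jacobian constraints z).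

(* Rank of the restriction of d Phi(z) to T_z M4: the dimension of the image
   of T_z M4 (jacobian matrices act on row vectors from the right). *)
Definition rank_dPhi (z : 'rV[R]_(3 + 3)) : nat :=
  \rank (tangentM4 z *m jacobian Phi z).

Definition S1 : set 'rV[R]_(3 + 3) := [set z | M4 z /\ rank_dPhi z = 1%N].

Definition gamma_of (theta phi : R) : 'rV[R]_3 :=
  row3 (sin theta * sin phi) (sin theta * cos phi) (cos theta).

Definition Zfun (theta : R) : R :=
  Num.sqrt (beta ^+ 2 * sin theta ^+ 2 + cos theta ^+ 2).

(* The right-hand side of the expression for omega_0^2. *)
Definition omega0_sq (theta : R) : R :=
  (- eta * sin theta ^+ 2
     * ((1 - beta ^+ 2) * cos theta + alpha * Zfun theta))
  / (cos theta * Zfun theta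
     * (eta * (Zfun theta + alpha * cos theta) ^+ 2
        + cos theta ^+ 2 + nu * sin theta ^+ 2)).

Definition S1_0 : set 'rV[R]_(3 + 3) :=
  [set z | exists omega3 theta phi : R,
    [/\ theta = pi / 2, 0 <= phi < 2 * pi &
        z = row_mx (row3 0 0 omega3) (gamma_of theta phi)]].

Definition S1_alpha : set 'rV[R]_(3 + 3) :=
  [set z | exists theta phi omega0 : R,
    [/\ 0 < theta < pi /\ theta <> pi / 2,
        0 <= phi < 2 * pi,
        0 <= omega0_sq theta,
        omega0 ^+ 2 = omega0_sq theta &
        let g := gamma_of theta phi in
        z = row_mx
              (omega0 *: ((enorm (cross (e3 R) g))^-1 *:
                            cross g (cross (e3 R) g))) g]].

End Ellipsoid.

Arguments S1_0 R : clear implicits.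

(* Main.v *)
Require Import Defs.
From HB Require Import structures.
From mathcomp Require Import all_boot all_order all_algebra.
From mathcomp Require Import all_classical all_reals all_analysis.
From mathcomp Require Import ring.
Import Order.TTheory GRing.Theory Num.Theory.
Import numFieldNormedType.Exports.
Local Open Scope classical_set_scope.
Local Open Scope ring_scope.

(** Write c for the third coordinate of gamma and m = e3 - c gamma, so that
(m, m) = 1 - c^2.  For alpha = 0 one has (r, gamma) = - Z with
Z^2 = beta^2 (1 - c^2) + c^2.  Off the poles c = 1 and c = - 1, an angular
velocity orthogonal to gamma is a combination of the orthogonal vectors m
(meridional) and e3 x gamma (horizontal), omega = t m + k (e3 x gamma).
Since r lies in the plane of gamma and e3, the energy is then diagonal:

    E = A k^2 (1 - c^2) / 2 + F2^2 / (2 (1 - c^2)) + Z,    A = 1/eta + |r|^2 > 0.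

The differential of F2 does not vanish there, so the rank is one exactly when
dE is a multiple of dF2.  Differentiating along m in the omega direction forces
the multiplier to be F2 / (1 - c^2).  Thus the rank is one exactly when the form
dE - F2 / (1 - c^2) dF2 vanishes on the tangent space; up to the factor 1 - c^2
this is [multiplier_form].

The tangent space is spanned by four vectors: the changes of omega along
e3 x gamma and along m, a displacement of gamma along the meridian, and the
rotation about e3.  The form vanishes on the second
([multiplier_form_merid]) and, by symmetry, on the fourth
([multiplier_form_rotation]).  On the first ([multiplier_form_paral]) it is a
nonzero multiple of k, so k = 0; on the third, when k = 0
([multiplier_form_merid_transport]), it is a nonzero multiple of
c ((1 - beta^2) / Z + t^2 J^2).  The two factors give the two families: c = 0 is
the equator, and t^2 J^2 Z = beta^2 - 1 is the formula for omega_0^2, because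
omega_0 = t sin theta.  At the poles the rank is 0 if omega = 0 and 2 otherwise
([rank_pole]).  The resulting criterion is [critical_iff]; it remains to pass to
spherical coordinates. *)
Set Implicit Arguments.
Unset Strict Implicit.
Unset Printing Implicit Defensive.

(** * Coordinates of row vectors *)

Section Rows.
Variable R : realType.
Implicit Types u v : 'rV[R]_3.

Lemma row3_eta u : u = row3 (u 0 0) (u 0 1) (u 0 2).
Proof.
apply/rowP => i; rewrite mxE.
by case: i => [[|[|[|//]]] hi] /=; congr (u _ _); apply: val_inj.
Qed.

Lemma row3_0 (a b c : R) : row3 a b c 0 0 = a. Proof. by rewrite mxE. Qed.
Lemma row3_1 (a b c : R) : row3 a b c 0 1 = b. Proof. by rewrite mxE. Qed.
Lemma row3_2 (a b c : R) : row3 a b c 0 2 = c. Proof. by rewrite mxE. Qed.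
Definition row3E := (row3_0, row3_1, row3_2).

Lemma row3Z (k a b c : R) : k *: row3 a b c = row3 (k * a) (k * b) (k * c).
Proof. by rewrite [LHS]row3_eta !mxE. Qed.

Lemma row2_eta (u : 'rV[R]_2) : u = row2 (u 0 0) (u 0 1).
Proof.
apply/rowP => i; rewrite mxE.
by case: i => [[|[|//]] hi] /=; congr (u _ _); apply: val_inj.
Qed.

Lemma row2_0 (a b : R) : row2 a b 0 0 = a. Proof. by rewrite mxE. Qed.
Lemma row2_1 (a b : R) : row2 a b 0 1 = b. Proof. by rewrite mxE. Qed.

Lemma row2_eq0 (a b : R) : row2 a b = 0 <-> a = 0 /\ b = 0.
Proof.
split=> [h|[-> ->]].
  by split; [rewrite -(row2_0 a b) | rewrite -(row2_1 a b)]; rewrite h mxE.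
by rewrite [LHS]row2_eta [RHS]row2_eta !mxE.
Qed.

Lemma dotE u v : dot u v = u 0 0 * v 0 0 + u 0 1 * v 0 1 + u 0 2 * v 0 2.
Proof.
rewrite /dot mxE !big_ord_recl big_ord0 !mxE addr0 addrA.
have -> : (lift ord0 ord0 : 'I_3) = 1 by apply: val_inj.
by have -> : (lift ord0 (lift ord0 ord0) : 'I_3) = 2%:R by apply: val_inj.
Qed.

Lemma dotZl k (u v : 'rV[R]_3) : dot (k *: u) v = k * dot u v.
Proof. by rewrite !dotE !mxE; ring. Qed.

Lemma dotZr k (u v : 'rV[R]_3) : dot u (k *: v) = k * dot u v.
Proof. by rewrite !dotE !mxE; ring. Qed.

Lemma dotC (u v : 'rV[R]_3) : dot u v = dot v u.
Proof. by rewrite !dotE; ring. Qed.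

Lemma dotDr (u v1 v2 : 'rV[R]_3) : dot u (v1 + v2) = dot u v1 + dot u v2.
Proof. by rewrite !dotE !mxE; ring. Qed.

Lemma dot0r u : dot u 0 = 0.
Proof. by rewrite dotE !mxE !mulr0 !addr0. Qed.

Lemma dot_ge0 u : 0 <= dot u u.
Proof. by rewrite dotE -!expr2 !addr_ge0 ?sqr_ge0. Qed.

End Rows.

Section Coordinates.
Variable R : realType.
Implicit Types z v : 'rV[R]_(3 + 3).

Lemma omega_row_mx (w g : 'rV[R]_3) : omega (row_mx w g) = w.
Proof. exact: row_mxKl. Qed.
Lemma gamma_row_mx (w g : 'rV[R]_3) : gamma (row_mx w g) = g.
Proof. exact: row_mxKr. Qed.

End Coordinates.

(** * Rules for differentials of real functions *)

Section DiffRules.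
Variables (R : realType) (V : normedModType R).
Implicit Types (f g df dg : V -> R) (z : V).

Lemma is_diff_ext (W : normedModType R) (F F' dF dF' : V -> W) z :
  is_diff z F dF -> F =1 F' -> dF =1 dF' -> is_diff z F' dF'.
Proof. by move=> h /funext <- /funext <-. Qed.

Lemma is_diff_eqd (W : normedModType R) (F dF dF' : V -> W) (z : V) :
  is_diff z F dF -> dF =1 dF' -> is_diff z F dF'.
Proof. by move=> h /funext <-. Qed.

Lemma is_diff_add f g df dg z : is_diff z f df -> is_diff z g dg ->
  is_diff z (fun t => f t + g t) (fun v => df v + dg v).
Proof. by move=> hf hg; exact: (is_diffD hf hg). Qed.

Lemma is_diff_sub f g df dg z : is_diff z f df -> is_diff z g dg ->
  is_diff z (fun t => f t - g t) (fun v => df v - dg v).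
Proof. by move=> hf hg; exact: (is_diffB hf hg). Qed.

Lemma is_diff_mul f g df dg z : is_diff z f df -> is_diff z g dg ->
  is_diff z (fun t => f t * g t) (fun v => f z * dg v + g z * df v).
Proof. by move=> hf hg; exact: (is_diffM hf hg). Qed.

Lemma is_diff_sqr f df z : is_diff z f df ->
  is_diff z (fun t => f t ^+ 2) (fun v => 2 * f z * df v).
Proof.
by move=> hf; apply: is_diff_ext (is_diff_mul hf hf) _ _ => v; ring.
Qed.

Lemma is_diff_const (c : R) z : is_diff z (fun=> c) (fun=> 0).
Proof. exact: is_diff_cst. Qed.

(** The chain rule for a real outer function, in the form in which its
derivative at a point is usually known. *)
Lemma is_diff_compR (h : R -> R) h' f df z : is_diff z f df ->
  is_derive (f z) 1 h h' -> is_diff z (fun t => h (f t)) (fun v => h' * df v).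
Proof.
move=> hf [hd hh].
have dh : is_diff (f z) h (fun x => x * h').
  have D : differentiable h (f z) by exact/derivable1_diffP.
  apply: DiffDef => //; apply/funext => x.
  by rewrite diff1E // derive1E hh.
by apply: is_diff_ext (is_diff_comp hf dh) _ _ => // v /=; rewrite mulrC.
Qed.

Lemma is_diff_sqrt f df z : is_diff z f df -> 0 < f z ->
  is_diff z (fun t => Num.sqrt (f t)) (fun v => (2 * Num.sqrt (f z))^-1 * df v).
Proof. by move=> hf f0; apply: is_diff_compR hf _; exact: is_derive1_sqrt. Qed.

Lemma is_diff_inv f df z : is_diff z f df -> f z != 0 ->
  is_diff z (fun t => (f t)^-1) (fun v => - f z ^- 2 * df v).
Proof.
move=> hf f0; apply: (is_diff_compR (h := GRing.inv)) hf _.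
have := is_deriveV f0 (is_derive_id (f z) 1).
by rewrite /= scaler1 => h; apply: h.
Qed.

End DiffRules.

Section CoordDiff.
Variable R : realType.
Implicit Types z v : 'rV[R]_(3 + 3).

Lemma is_diff_coord z j :
  is_diff z (fun t : 'rV[R]_(3 + 3) => t 0 j : R) (fun v => v 0 j).
Proof.
have @f : {linear 'rV[R]_(3 + 3) -> R}.
  by exists (fun N : 'rV[R]_(3 + 3) => N 0 j); do 2![eexists]; do ?[constructor];
     rewrite ?mxE// => ? *; rewrite ?mxE//; move=> ?; rewrite !mxE.
have fc : continuous f by exact: coord_continuous.
apply: DiffDef; first exact: differentiable_coord.
exact: (diff_lin (f := f) z fc).
Qed.

Lemma is_diff_omega z i : is_diff z (fun t => omega t 0 i) (fun v => omega v 0 i).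
Proof.
by apply: is_diff_ext (is_diff_coord z (lshift 3 i)) _ _ => v; rewrite mxE.
Qed.

Lemma is_diff_gamma z i : is_diff z (fun t => gamma t 0 i) (fun v => gamma v 0 i).
Proof.
by apply: is_diff_ext (is_diff_coord z (rshift 3 i)) _ _ => v; rewrite mxE.
Qed.

Lemma is_diff_row2 (f g df dg : 'rV[R]_(3 + 3) -> R) z :
  is_diff z f df -> is_diff z g dg ->
  is_diff z (fun t => row2 (f t) (g t)) (fun v => row2 (df v) (dg v)).
Proof.
move=> [fd fE] [gd gE].
have e (a b : R) : row2 a b = a *: row2 1 0 + b *: row2 0 1.
  by rewrite [LHS]row2_eta [RHS]row2_eta !mxE /= !(mulr1, mulr0, addr0, add0r).
have df1 : is_diff z (fun t => f t *: row2 1 0)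
    (fun v => df v *: row2 1 0 : 'rV[R]_2).
  by apply: DiffDef; [exact: differentiableZl | rewrite diffZl // fE].
have dg1 : is_diff z (fun t => g t *: row2 0 1)
    (fun v => dg v *: row2 0 1 : 'rV[R]_2).
  by apply: DiffDef; [exact: differentiableZl | rewrite diffZl // gE].
by apply: is_diff_ext (is_diffD df1 dg1) _ _ => v /=; rewrite [RHS]e.
Qed.

Lemma mul_jacobian n m (F dF : 'rV[R]_n -> 'rV[R]_m) x u :
  is_diff x F dF -> u *m jacobian F x = dF u.
Proof. by case=> _ <-; rewrite /jacobian mul_rV_lin1. Qed.

End CoordDiff.

(** * Rank one on a kernel *)

Section Rank.
Variables (F : fieldType).

(** The row space of the product is the image of the kernel of C under D; it is
a line exactly when it is nonzero and its vectors are pairwise parallel, and in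
the plane parallelism is the vanishing of a determinant. *)
Lemma rank_kermx_mul_eq1 n m (C : 'M[F]_(n, m)) (D : 'M[F]_(n, 2)) :
  \rank (kermx C *m D) = 1%N <->
  (exists2 v : 'rV_n, v *m C = 0 & v *m D != 0) /\
  (forall u v : 'rV_n, u *m C = 0 -> v *m C = 0 ->
     (u *m D) 0 0 * (v *m D) 0 1 = (u *m D) 0 1 * (v *m D) 0 0).
Proof.
set A := kermx C *m D.
have ker (v : 'rV_n) : v *m C = 0 -> (v *m D <= A)%MS.
  by move=> vC; apply: submxMr; apply/sub_kermxP.
have kerC i : row i (kermx C) *m C = 0 by rewrite -row_mul mulmx_ker row0.
have rowA i : row i A = row i (kermx C) *m D by rewrite row_mul.
split=> [rA|[[v vC vD] par]].
  have [v vC vD] : exists2 v : 'rV_n, v *m C = 0 & v *m D != 0.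
    apply: contrapT => none; move: rA; rewrite (_ : A = 0) ?mxrank0 //.
    apply/row_matrixP => i; rewrite row0 rowA; apply/eqP/negPn/negP => nz.
    by apply: none; exists (row i (kermx C)).
  split=> [|u1 u2 /ker u1A /ker u2A]; first by exists v.
  have Av : (A <= v *m D)%MS.
    by rewrite -(geq_leqif (mxrank_leqif_sup (ker _ vC))) rA rank_rV vD.
  have /sub_rVP [a1 ->] := submx_trans u1A Av.
  have /sub_rVP [a2 ->] := submx_trans u2A Av.
  by rewrite !mxE; ring.
have Av : (A <= v *m D)%MS.
  apply/row_subP => i; rewrite rowA; apply/sub_rVP.
  have := par _ _ (kerC i) vC; move: (row i _ *m D) (v *m D) vD => a b b0 ab.
  have [b00|b00] := eqVneq (b 0 0) 0.
    have b01 : b 0 1 != 0.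
      apply: contra_neq b0 => b01; apply/rowP => j; rewrite mxE.
      by case: j => [[|[|//]] hj]; [rewrite -[RHS]b00 | rewrite -[RHS]b01];
        congr (b _ _); apply: val_inj.
    exists (a 0 1 / b 0 1); apply/rowP => j; rewrite mxE.
    case: j => [[|[|//]] hj].
      rewrite (_ : Ordinal hj = 0); last exact: val_inj.
      by apply: (mulIf b01); rewrite ab b00 !mulr0 mul0r.
    rewrite (_ : Ordinal hj = 1); last exact: val_inj.
    by rewrite divfK.
  exists (a 0 0 / b 0 0); apply/rowP => j; rewrite mxE.
  case: j => [[|[|//]] hj].
    rewrite (_ : Ordinal hj = 0); last exact: val_inj.
    by rewrite divfK.
  rewrite (_ : Ordinal hj = 1); last exact: val_inj.
  by apply: (mulIf b00); rewrite -ab; field.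
apply/eqP; rewrite eqn_leq; apply/andP; split.
  by apply: leq_trans (mxrankS Av) _; rewrite rank_rV vD.
by apply: leq_trans (mxrankS (ker _ vC)); rewrite rank_rV vD.
Qed.

End Rank.

(** * Spherical coordinates *)

Section Angles.
Variable R : realType.

(** If a >= 0 the angle is acos b, and otherwise 2 pi - acos b. *)
Lemma polar_unit (a b : R) : a ^+ 2 + b ^+ 2 = 1 ->
  exists phi : R, [/\ 0 <= phi < 2 * pi, sin phi = a & cos phi = b].
Proof.
move=> ab.
have b1 : -1 <= b <= 1.
  rewrite -ler_norml -[X in _ <= X](normr1 R) -ler_sqr ?nnegrE ?normr_ge0 //.
  by rewrite !real_normK ?num_real // expr1n -ab lerDr sqr_ge0.
have sa : sin (acos b) = `|a|.
  by rewrite sin_acos // -sqrtr_sqr -ab addrK.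
have cb : cos (acos b) = b by apply: acosK; rewrite in_itv.
have p0 : (0 : R) < pi by exact: pi_gt0.
have [a0|a0] := leP 0 a.
  exists (acos b); split => //; last by rewrite sa ger0_norm.
  rewrite acos_ge0 //=; apply: le_lt_trans (acos_lepi b1) _.
  by rewrite mulr_natl mulr2n ltrDl.
exists (2 * pi - acos b); split.
- rewrite subr_ge0 ltrBlDr ltrDl.
  apply/andP; split.
    apply: le_trans (acos_lepi b1) _.
    by rewrite mulr_natl mulr2n lerDl ltW.
  rewrite acos_gt0 //; case/andP: b1 => -> /=; rewrite lt_neqAle => ->.
  rewrite andbT; apply/eqP => be; move: ab; rewrite be expr1n => /eqP.
  by rewrite -subr_eq0 addrK sqrf_eq0 lt_eqF.
- rewrite mulr_natl mulr2n -addrA addrC sinDpi -opprB sinN.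
  rewrite opprK sinB cospi sinpi sa ler0_norm ?ltW //; ring.
- rewrite mulr_natl mulr2n -addrA addrC cosDpi cosB cospi sinpi cb; ring.
Qed.

Lemma cos_eq0_pihalf (theta : R) :
  0 < theta < pi -> cos theta = 0 -> theta = pi / 2.
Proof.
case/andP=> /ltW t0 /ltW tp c0; apply: cos_inj; last by rewrite cos_pihalf.
  by rewrite in_itv /= t0.
by rewrite in_itv /= divr_ge0 ?pi_ge0 //= ler_pdivrMr // ler_peMr ?pi_ge0 ?ler1n.
Qed.

Lemma spherical (x y c : R) : x ^+ 2 + y ^+ 2 + c ^+ 2 = 1 ->
  1 - c ^+ 2 != 0 ->
  exists theta phi : R, [/\ 0 < theta < pi, 0 <= phi < 2 * pi &
    row3 x y c = gamma_of theta phi].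
Proof.
move=> g1 c1.
have s2 : 0 < 1 - c ^+ 2.
  by rewrite lt_def c1 -g1 addrK addr_ge0 ?sqr_ge0.
have cc : -1 < c < 1.
  rewrite -ltr_norml -(@ltr_pXn2r _ 2) ?nnegrE // expr1n.
  by rewrite real_normK ?num_real // -subr_gt0.
have cc' : -1 <= c <= 1 by case/andP: cc => /ltW -> /ltW ->.
have ca : cos (acos c) = c by apply: acosK; rewrite in_itv.
pose s := Num.sqrt (1 - c ^+ 2).
have s0 : s != 0 by rewrite gt_eqF // sqrtr_gt0.
have ss : s ^+ 2 = 1 - c ^+ 2 by rewrite sqr_sqrtr // ltW.
have [|phi [p1 p2 p3]] := @polar_unit (x / s) (y / s).
  by rewrite !expr_div_n -mulrDl ss -[X in X / _](addrK (c ^+ 2)) g1 divff.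
exists (acos c), phi; split=> //.
  by case/andP: cc => h1 h2; rewrite acos_gt0 ?acos_ltpi ?(ltW h1) ?(ltW h2) ?h1.
rewrite /gamma_of p2 p3 ca sin_acos // -/s.
by congr row3; rewrite mulrC divfK.
Qed.

End Angles.

(** * The integrals in coordinates *)

Section Ellipsoid.
Variable R : realType.
Variables beta nu eta : R.
Implicit Types (g w h u : 'rV[R]_3) (z : 'rV[R]_(3 + 3)).

(** With r = - shape g / Z, these are (r, gamma)^2 = Z^2 and J^2 without
square roots. *)
Definition Zsq g : R := beta ^+ 2 * (g 0 0 ^+ 2 + g 0 1 ^+ 2) + g 0 2 ^+ 2.
Definition Jsq g : R := eta^-1 * (g 0 2 ^+ 2 + nu * (1 - g 0 2 ^+ 2)) + Zsq g.
Definition shape g : 'rV[R]_3 :=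
  row3 (beta ^+ 2 * g 0 0) (beta ^+ 2 * g 0 1) (g 0 2).
(** Twice the kinetic energy of the rotation about the center of mass. *)
Definition kin w : R := eta^-1 * (w 0 0 ^+ 2 + w 0 1 ^+ 2 + nu * w 0 2 ^+ 2).
(** The Gram determinant |B gamma|^2 |omega|^2 - (B gamma, omega)^2 with
B = diag(beta^2, beta^2, 1); divided by Z^2 it is the part of (J omega, omega)
that comes from |r|^2 E_3 - r (x) r. *)
Definition gram w g : R := dot (shape g) (shape g) * dot w w - dot (shape g) w ^+ 2.

Lemma Zsq_ge0 g : 0 <= Zsq g.
Proof.
by apply: addr_ge0 (sqr_ge0 _); apply: mulr_ge0 (sqr_ge0 _) (addr_ge0 _ _);
  apply: sqr_ge0.
Qed.

Lemma dot_shape g : dot (shape g) g = Zsq g.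
Proof. by rewrite dotE !row3E /Zsq; ring. Qed.

Lemma rvec0E g : rvec 0 beta g = (- (Num.sqrt (Zsq g))^-1) *: shape g.
Proof. by rewrite /rvec scale0r subr0 scaleNr. Qed.

(** True also at x = 0 because 0^-1 = 0; hence the coordinate expressions of F2
and of the energy hold on the whole space, where they can be differentiated
without restricting to a neighborhood. *)
Lemma invr_sqrtK (x : R) : 0 <= x -> (Num.sqrt x)^-1 * x = Num.sqrt x.
Proof.
move=> x0; rewrite -{2}(sqr_sqrtr x0) expr2.
by have [->|s0] := eqVneq (Num.sqrt x) 0; rewrite ?mulr0 // mulKf.
Qed.

Lemma dot_rvec g : dot (rvec 0 beta g) g = - Num.sqrt (Zsq g).
Proof. by rewrite rvec0E dotZl dot_shape mulNr invr_sqrtK ?Zsq_ge0. Qed.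

(** Squaring (r, gamma) = - Z removes the inner square root from J. *)
Lemma F2E z : F2 0 beta nu eta z = Num.sqrt (Jsq (gamma z)) * omega z 0 2.
Proof. by rewrite /F2 /Jfun dot_rvec sqrrN sqr_sqrtr ?Zsq_ge0. Qed.

Lemma dot_Jmx w g :
  dot (w *m Jmx 0 beta nu eta g) w =
  kin w + (dot (rvec 0 beta g) (rvec 0 beta g) * dot w w
           - dot (rvec 0 beta g) w ^+ 2).
Proof.
set r := rvec 0 beta g.
have -> : w *m Jmx 0 beta nu eta g =
    w *m inertia nu eta + dot r r *: w - dot r w *: r.
  rewrite /Jmx mulmxBr mulmxDr mul_mx_scalar; congr (_ - _).
  rewrite mulmxA (mx11_scalar (w *m _)) mul_scalar_mx.
  by rewrite -[(w *m r^T) 0 0]/(dot w r) dotC.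
have -> : w *m inertia nu eta =
    row3 (eta^-1 * w 0 0) (eta^-1 * w 0 1) (nu / eta * w 0 2).
  rewrite [LHS]row3_eta /inertia mul_mx_diag !mxE /=.
  by congr row3; rewrite mulrC.
clearbody r; rewrite [LHS]dotE !mxE /= !dotE /kin; ring.
Qed.

Lemma energyE z :
  energy 0 beta nu eta z =
  2^-1 * (kin (omega z) + gram (omega z) (gamma z) * (Zsq (gamma z))^-1)
  + Num.sqrt (Zsq (gamma z)).
Proof.
rewrite /energy dot_Jmx dot_rvec opprK; congr (_ * (_ + _) + _).
have iZ : (Num.sqrt (Zsq (gamma z)))^-1 ^+ 2 = (Zsq (gamma z))^-1.
  by rewrite exprVn sqr_sqrtr ?Zsq_ge0.
by rewrite rvec0E !dotZl !dotZr -iZ /gram; ring.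
Qed.

(** * Differentials of the integrals *)

Definition dZsq g h : R := 2 * dot (shape g) h.
Definition dJsq g h : R := 2 * eta^-1 * (1 - nu) * (g 0 2 * h 0 2) + dZsq g h.
Definition dgram w g u h : R :=
  2 * (dot (shape g) (shape h) * dot w w + dot (shape g) (shape g) * dot w u
       - dot (shape g) w * (dot (shape h) w + dot (shape g) u)).
Definition dkin w u : R :=
  2 * eta^-1 * (w 0 0 * u 0 0 + w 0 1 * u 0 1 + nu * (w 0 2 * u 0 2)).

Definition dF2 w g u h : R :=
  (2 * Num.sqrt (Jsq g))^-1 * dJsq g h * w 0 2 + Num.sqrt (Jsq g) * u 0 2.

Definition denergy w g u h : R :=
  2^-1 * (dkin w u + dgram w g u h / Zsq g - gram w g / Zsq g ^+ 2 * dZsq g h)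
  + (2 * Num.sqrt (Zsq g))^-1 * dZsq g h.

(* The rule for differences precedes the one for sums, since a difference is
also a sum with an opposite.  Typeclass resolution is avoided: it would give
the differentials as combinations of functions instead of pointwise formulas. *)
Ltac diff_rules := repeat first
  [ notypeclasses refine (is_diff_const _ _)
  | notypeclasses refine (is_diff_omega _ _)
  | notypeclasses refine (is_diff_gamma _ _)
  | notypeclasses refine (is_diff_sub _ _)
  | notypeclasses refine (is_diff_add _ _)
  | notypeclasses refine (is_diff_sqr _)
  | notypeclasses refine (is_diff_mul _ _) ].

Lemma is_diff_Zsq z :
  is_diff z (fun t => Zsq (gamma t)) (fun v => dZsq (gamma z) (gamma v)).
Proof.
rewrite /Zsq; refine (is_diff_eqd (dF := _) _ _); first by diff_rules.
by move=> v; rewrite /dZsq dotE !row3E /=; ring.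
Qed.

Lemma is_diff_Jsq z :
  is_diff z (fun t => Jsq (gamma t)) (fun v => dJsq (gamma z) (gamma v)).
Proof.
rewrite /Jsq; refine (is_diff_eqd (dF := _) _ _).
  by notypeclasses refine (is_diff_add _ (is_diff_Zsq z)); diff_rules.
by move=> v; rewrite /dJsq /=; ring.
Qed.

Lemma is_diff_kin z :
  is_diff z (fun t => kin (omega t)) (fun v => dkin (omega z) (omega v)).
Proof.
rewrite /kin; refine (is_diff_eqd (dF := _) _ _); first by diff_rules.
by move=> v; rewrite /dkin /=; ring.
Qed.

Lemma is_diff_gram z :
  is_diff z (fun t => gram (omega t) (gamma t))
    (fun v => dgram (omega z) (gamma z) (omega v) (gamma v)).
Proof.
refine (is_diff_eqd (dF := _) _ _).
  (* Expanded in coordinates, so that the rules apply syntactically. *)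
  apply: (@is_diff_ext _ _ _ (fun t => (beta ^+ 2 * beta ^+ 2 *
    (gamma t 0 0 ^+ 2 + gamma t 0 1 ^+ 2) + gamma t 0 2 ^+ 2)
   * (omega t 0 0 ^+ 2 + omega t 0 1 ^+ 2 + omega t 0 2 ^+ 2)
   - (beta ^+ 2 * (gamma t 0 0 * omega t 0 0 + gamma t 0 1 * omega t 0 1)
      + gamma t 0 2 * omega t 0 2) ^+ 2)).
  - by diff_rules.
  - by move=> t; rewrite /gram !dotE !row3E /=; ring.
  - by move=> v; reflexivity.
by move=> v; rewrite /dgram !dotE !row3E /=; ring.
Qed.

Lemma is_diff_F2 z : 0 < Jsq (gamma z) ->
  is_diff z (F2 0 beta nu eta)
    (fun v => dF2 (omega z) (gamma z) (omega v) (gamma v)).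
Proof.
move=> J0; refine (is_diff_ext (is_diff_mul (is_diff_sqrt (is_diff_Jsq z) J0)
  (is_diff_omega z 2)) _ _); first by move=> t; rewrite F2E.
by move=> v /=; rewrite /dF2; ring.
Qed.

Lemma is_diff_energy z : 0 < Zsq (gamma z) ->
  is_diff z (energy 0 beta nu eta)
    (fun v => denergy (omega z) (gamma z) (omega v) (gamma v)).
Proof.
move=> Z0; have Qn : Zsq (gamma z) != 0 by rewrite gt_eqF.
refine (is_diff_ext (is_diff_add (is_diff_mul (is_diff_const 2^-1 z)
  (is_diff_add (is_diff_kin z) (is_diff_mul (is_diff_gram z)
    (is_diff_inv (is_diff_Zsq z) Qn)))) (is_diff_sqrt (is_diff_Zsq z) Z0)) _ _).
  by move=> t; rewrite energyE.
by move=> v /=; rewrite /denergy; ring.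
Qed.

Lemma is_diff_F0 z :
  is_diff z (@F0 R) (fun v => 2 * dot (gamma z) (gamma v)).
Proof.
refine (is_diff_eqd (dF := _) _ _).
  apply: (@is_diff_ext _ _ _ (fun t =>
    gamma t 0 0 ^+ 2 + gamma t 0 1 ^+ 2 + gamma t 0 2 ^+ 2)).
  - by diff_rules.
  - by move=> t; rewrite /F0 dotE; ring.
  - by move=> v; reflexivity.
by move=> v; rewrite dotE /=; ring.
Qed.

Lemma is_diff_F1 z :
  is_diff z (@F1 R)
    (fun v => dot (omega z) (gamma v) + dot (gamma z) (omega v)).
Proof.
refine (is_diff_eqd (dF := _) _ _).
  apply: (@is_diff_ext _ _ _ (fun t =>
    omega t 0 0 * gamma t 0 0 + omega t 0 1 * gamma t 0 1
    + omega t 0 2 * gamma t 0 2)).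
  - by diff_rules.
  - by move=> t; rewrite /F1 dotE.
  - by move=> v; reflexivity.
by move=> v; rewrite !dotE /=; ring.
Qed.

Lemma mul_jacobian_Phi w g u h : 0 < Jsq g -> 0 < Zsq g ->
  row_mx u h *m jacobian (Phi 0 beta nu eta) (row_mx w g) =
  row2 (dF2 w g u h) (denergy w g u h).
Proof.
move=> J0 Z0; set z := row_mx w g.
have [hP hZ] : 0 < Jsq (gamma z) /\ 0 < Zsq (gamma z) by rewrite gamma_row_mx.
rewrite (mul_jacobian _ (is_diff_row2 (is_diff_F2 hP) (is_diff_energy hZ))).
by rewrite !omega_row_mx !gamma_row_mx.
Qed.

Lemma mul_jacobian_constraints w g u h :
  row_mx u h *m jacobian (@constraints R) (row_mx w g) =
  row2 (2 * dot g h) (dot w h + dot g u).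
Proof.
rewrite (mul_jacobian _ (is_diff_row2 (is_diff_F0 _) (is_diff_F1 _))).
by rewrite !omega_row_mx !gamma_row_mx.
Qed.

Hypotheses (beta_gt0 : 0 < beta) (nu_gt0 : 0 < nu) (eta_gt0 : 0 < eta).

(** * The rank in terms of tangent vectors *)

(** The kernel of the differential of the constraints at (w, g), for a
variation (u, h) of (omega, gamma). *)
Definition tangent w g u h := dot g h = 0 /\ dot w h + dot g u = 0.

Lemma rank_dPhiE w g : 0 < Jsq g -> 0 < Zsq g ->
  rank_dPhi 0 beta nu eta (row_mx w g) = 1%N <->
  (exists u h, tangent w g u h /\ ~ (dF2 w g u h = 0 /\ denergy w g u h = 0)) /\
  (forall u h u' h', tangent w g u h -> tangent w g u' h' ->
     dF2 w g u h * denergy w g u' h' = denergy w g u h * dF2 w g u' h').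
Proof.
move=> J0 Z0; rewrite /rank_dPhi /tangentM4.
have tanE u h : row_mx u h *m jacobian (@constraints R) (row_mx w g) = 0 <->
    tangent w g u h.
  rewrite mul_jacobian_constraints row2_eq0 /tangent.
  split=> -[h1 h2]; split=> //; last by rewrite h1 mulr0.
  by move/eqP: h1; rewrite mulf_eq0 pnatr_eq0 /= => /eqP.
rewrite rank_kermx_mul_eq1; split=> -[].
  case=> v; rewrite -(hsubmxK v) => /tanE vt; rewrite mul_jacobian_Phi //.
  move=> /eqP nz par.
  split=> [|u h u' h' /tanE t /tanE t'].
    by exists (lsubmx v), (rsubmx v); split=> // /row2_eq0.
  by have := par _ _ t t'; rewrite !mul_jacobian_Phi // !row2_0 !row2_1.
case=> u [h [/tanE t nz]] par; split.
  by exists (row_mx u h) => //; rewrite mul_jacobian_Phi //; apply/eqP => /row2_eq0.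
move=> v v'; rewrite -(hsubmxK v) -(hsubmxK v') => /tanE t1 /tanE t2.
by rewrite !mul_jacobian_Phi // !row2_0 !row2_1; exact: par.
Qed.

Lemma coord2_le1 g : dot g g = 1 -> g 0 2 ^+ 2 <= 1.
Proof.
rewrite dotE => <-; rewrite -!expr2 lerDr; exact: addr_ge0 (sqr_ge0 _) (sqr_ge0 _).
Qed.

Lemma Zsq_gt0 g : dot g g = 1 -> 0 < Zsq g.
Proof.
rewrite dotE -!expr2 => g1; rewrite lt_def Zsq_ge0 andbT; apply/eqP => /eqP.
rewrite /Zsq paddr_eq0 ?sqr_ge0 //; last first.
  by apply: mulr_ge0 (sqr_ge0 _) (addr_ge0 (sqr_ge0 _) (sqr_ge0 _)).
rewrite mulf_eq0 sqrf_eq0 (gt_eqF beta_gt0) /= => /andP[/eqP xy /eqP z].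
by move: g1; rewrite xy z addr0 => /esym/eqP; rewrite oner_eq0.
Qed.

Lemma Jsq_gt0 g : dot g g = 1 -> 0 < Jsq g.
Proof.
move=> g1; rewrite /Jsq; apply: ltr_wpDl (Zsq_gt0 g1).
apply: mulr_ge0; first by rewrite invr_ge0 ltW.
apply: addr_ge0 (sqr_ge0 _) _; apply: mulr_ge0; first exact: ltW.
by rewrite subr_ge0 coord2_le1.
Qed.

(** (1 - c^2) dE - F2 dF2, with the square root in F2 dF2 multiplied out: by
F2 = J omega_3 one has F2 dF2 = omega_3 (J^2 d omega_3 + omega_3 d(J^2) / 2).
See [multiplier_formE]. *)
Definition multiplier_form w g u h : R :=
  (1 - g 0 2 ^+ 2) * denergy w g u h
  - w 0 2 * (Jsq g * u 0 2 + 2^-1 * w 0 2 * dJsq g h).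

Lemma multiplier_formE w g u h : 0 < Jsq g ->
  multiplier_form w g u h =
  (1 - g 0 2 ^+ 2) * denergy w g u h - w 0 2 * Num.sqrt (Jsq g) * dF2 w g u h.
Proof.
move=> J0; rewrite /multiplier_form /dF2; congr (_ - _).
have := sqr_sqrtr (ltW J0).
have : Num.sqrt (Jsq g) != 0 by rewrite gt_eqF // sqrtr_gt0.
by move: (Num.sqrt _) => s s0 <-; field.
Qed.

Lemma multiplier_formDZ w g a u u' h h' :
  multiplier_form w g (a *: u + u') (a *: h + h') =
  a * multiplier_form w g u h + multiplier_form w g u' h'.
Proof.
rewrite /multiplier_form /denergy /dgram /dJsq /dZsq /dkin !dotE !row3E !mxE; ring.
Qed.

(** * The multiplier form on a frame of the tangent space *)

(** On unit vectors these are e3 - c gamma and e3 x gamma, an orthogonal basis of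
the plane orthogonal to gamma away from the poles. *)
Definition merid (x y c : R) : 'rV[R]_3 :=
  row3 (- (c * x)) (- (c * y)) (1 - c ^+ 2).
Definition paral (x y : R) : 'rV[R]_3 := row3 (- y) x 0.

(** F2 does not change, and E changes only by its k-part A k^2 (1 - c^2) / 2. *)
Lemma multiplier_form_paral x y c t k : x ^+ 2 + y ^+ 2 + c ^+ 2 = 1 ->
  let g := row3 x y c in let w := t *: merid x y c + k *: paral x y in
  multiplier_form w g (paral x y) 0 =
  (1 - c ^+ 2) ^+ 2 * (eta^-1 + dot (shape g) (shape g) / Zsq g) * k.
Proof.
move=> g1 g w.
have hy : y ^+ 2 = 1 - x ^+ 2 - c ^+ 2 by rewrite -g1; ring.
have hZ : dZsq g 0 = 0 by rewrite /dZsq dotE !mxE; ring.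
have hN : dgram w g (paral x y) 0 =
    2 * (dot (shape g) (shape g) * (k * (1 - c ^+ 2))).
  rewrite /dgram !dotE !row3E !mxE /=; ring: hy.
have hK : dkin w (paral x y) = 2 * eta^-1 * (k * (1 - c ^+ 2)).
  rewrite /dkin !mxE /=; ring: hy.
rewrite /multiplier_form /denergy hZ hN hK /dJsq hZ !row3E !mxE.
rewrite !mulr0 !addr0 subr0.
by move: (Zsq g)^-1 (dot _ _) (eta^-1) => *; field.
Qed.

(** E depends on the meridional part of omega through F2^2 / (2 (1 - c^2)) only,
so the two terms cancel; this is the direction that fixes the multiplier. *)
Lemma multiplier_form_merid x y c w : x ^+ 2 + y ^+ 2 + c ^+ 2 = 1 ->
  let g := row3 x y c in dot w g = 0 ->
  multiplier_form w g (merid x y c) 0 = 0.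
Proof.
move=> g1 g; rewrite dotE !row3E => wg.
have hy : y ^+ 2 = 1 - x ^+ 2 - c ^+ 2 by rewrite -g1; ring.
have hw : w 0 1 * y = - (w 0 0 * x + w 0 2 * c) by rewrite -[RHS]addr0 -wg; ring.
have g1' : dot g g = 1 by rewrite /g dotE !row3E -g1; ring.
have Z0 : Zsq g != 0 by rewrite gt_eqF // Zsq_gt0.
have gZ : Zsq g = beta ^+ 2 * (1 - c ^+ 2) + c ^+ 2.
  by rewrite /Zsq !row3E; ring: hy.
have hZ : dZsq g 0 = 0 by rewrite /dZsq dotE !mxE; ring.
have hU : dot (shape g) (shape g) = beta ^+ 4 * (1 - c ^+ 2) + c ^+ 2.
  by rewrite dotE !row3E; ring: hy.
have hV : dot (shape g) w = (1 - beta ^+ 2) * c * w 0 2.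
  by rewrite dotE !row3E; ring: hw.
have hBm : dot (shape g) (merid x y c) = c * (1 - beta ^+ 2) * (1 - c ^+ 2).
  by rewrite dotE !row3E; ring: hy.
have hwm : dot w (merid x y c) = w 0 2.
  by rewrite dotE !row3E; ring: hw.
have hB0 : shape (0 : 'rV[R]_3) = 0.
  by rewrite [LHS]row3_eta [RHS]row3_eta !mxE !mulr0.
have hN : dgram w g (merid x y c) 0 = 2 * w 0 2 * Zsq g ^+ 2.
  rewrite /dgram hU hV hBm hwm hB0 gZ !dotE !mxE; ring.
have hK : dkin w (merid x y c) = 2 * eta^-1 * w 0 2 * (c ^+ 2 + nu * (1 - c ^+ 2)).
  by rewrite /dkin !row3E; ring: hw.
rewrite /multiplier_form /denergy hZ hN hK /dJsq hZ /Jsq !row3E.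
rewrite !(mxE, mulr0, addr0, subr0) gZ; move: Z0; rewrite gZ.
move: (eta^-1) => e q0.
by field.
Qed.

(** The integrals are invariant under rotations about e3, so both
differentials vanish on (e3 x omega, e3 x gamma). *)
Lemma multiplier_form_rotation w g :
  multiplier_form w g (row3 (- w 0 1) (w 0 0) 0) (row3 (- g 0 1) (g 0 0) 0) = 0.
Proof.
have hZ : dZsq g (row3 (- g 0 1) (g 0 0) 0) = 0 by rewrite /dZsq dotE !row3E; ring.
rewrite /multiplier_form /denergy /dJsq hZ /dgram /dkin !dotE !row3E; ring.
Qed.

(** Here gamma moves along the meridian and - omega_3 gamma is a change of
omega that keeps omega orthogonal to gamma.  At k = 0 the form is
(1 - c^2) times the derivative of F2^2 / (2 (1 - c^2)) + Z at constant F2. *)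
Lemma multiplier_form_merid_transport x y c t : x ^+ 2 + y ^+ 2 + c ^+ 2 = 1 ->
  let g := row3 x y c in let w := t *: merid x y c in
  multiplier_form w g (- w 0 2 *: g) (merid x y c) =
  c * (1 - c ^+ 2) ^+ 2 * ((1 - beta ^+ 2) / Num.sqrt (Zsq g) + t ^+ 2 * Jsq g).
Proof.
move=> g1 g w.
have hy : y ^+ 2 = 1 - x ^+ 2 - c ^+ 2 by rewrite -g1; ring.
have g1' : dot g g = 1 by rewrite /g dotE !row3E -g1; ring.
have Z0 : Zsq g != 0 by rewrite gt_eqF // Zsq_gt0.
have S0 : Num.sqrt (Zsq g) != 0 by rewrite gt_eqF // sqrtr_gt0 Zsq_gt0.
have gZ : Zsq g = beta ^+ 2 * (1 - c ^+ 2) + c ^+ 2.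
  by rewrite /Zsq !row3E; ring: hy.
have hZ : dZsq g (merid x y c) = 2 * (1 - beta ^+ 2) * c * (1 - c ^+ 2).
  by rewrite /dZsq dotE !row3E; ring: hy.
(* omega stays in the plane of gamma and e3 to first order, where the Gram
   determinant is |omega|^2 Z^4, and |omega| is stationary. *)
have hNw : gram w g = t ^+ 2 * (1 - c ^+ 2) * Zsq g ^+ 2.
  rewrite /gram gZ !dotE !row3E !mxE /=; ring: hy.
have hN : dgram w g (- w 0 2 *: g) (merid x y c) =
    t ^+ 2 * (1 - c ^+ 2) * (2 * Zsq g * dZsq g (merid x y c)).
  rewrite hZ gZ /dgram !dotE !row3E !mxE /=; ring: hy.
have hK : dkin w (- w 0 2 *: g) =
    2 * eta^-1 * (1 - nu) * t ^+ 2 * (1 - c ^+ 2) ^+ 2 * c.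
  rewrite /dkin !mxE /=; ring: hy.
rewrite /multiplier_form /denergy hN hK hNw /dJsq hZ !row3E.
rewrite !(mxE, row3E) /=.
move: Z0 S0; move: (Zsq g) (Num.sqrt _) (eta^-1) (Jsq g) => q s e p q0 s0.
by field; rewrite s0 q0.
Qed.

Lemma dot_merid u x y c :
  dot u (merid x y c) = u 0 2 - c * dot u (row3 x y c).
Proof. by rewrite !dotE !row3E; ring. Qed.

(** * The critical points *)

(** The vector (m, 0) is tangent, F2 has the nonzero derivative J (1 - c^2) along
it, and the multiplier form vanishes on it.  So the image of (m, 0) spans the
kernel of (x, y) |-> (1 - c^2) y - F2 x, and the image of the tangent space
is a line exactly when it is contained in this kernel. *)
Lemma rank_off_pole w g : dot g g = 1 -> dot w g = 0 -> 1 - g 0 2 ^+ 2 != 0 ->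
  rank_dPhi 0 beta nu eta (row_mx w g) = 1%N <->
  forall u h, tangent w g u h -> multiplier_form w g u h = 0.
Proof.
move=> g1 wg c1; have [J0 Z0] := (Jsq_gt0 g1, Zsq_gt0 g1).
have S0 : Num.sqrt (Jsq g) != 0 by rewrite gt_eqF // sqrtr_gt0.
rewrite rank_dPhiE //.
pose m := merid (g 0 0) (g 0 1) (g 0 2).
have mt : tangent w g m 0.
  by rewrite /tangent !dot0r dot_merid -row3_eta g1 add0r mulr1 subrr.
have mF : dF2 w g m 0 = Num.sqrt (Jsq g) * (1 - g 0 2 ^+ 2).
  by rewrite /dF2 /dJsq /dZsq dotE !mxE /=; ring.
have mL : multiplier_form w g m 0 = 0.
  have := @multiplier_form_merid (g 0 0) (g 0 1) (g 0 2) w.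
  rewrite -row3_eta; apply => //.
  by rewrite -g1 dotE; ring.
have mL' := mL; rewrite multiplier_formE // in mL'.
split=> [[_ par] u h t|L0].
  have := par _ _ _ _ t mt; rewrite mF multiplier_formE // => e.
  apply: (mulfI S0); rewrite mulr0 mulrBr.
  have -> : Num.sqrt (Jsq g) * ((1 - g 0 2 ^+ 2) * denergy w g u h) =
            denergy w g u h * (Num.sqrt (Jsq g) * (1 - g 0 2 ^+ 2)) by ring.
  rewrite -e; apply: (mulfI c1); rewrite mulr0.
  transitivity (dF2 w g u h * ((1 - g 0 2 ^+ 2) * denergy w g m 0 -
     w 0 2 * Num.sqrt (Jsq g) * dF2 w g m 0)); last by rewrite mL' mulr0.
  by rewrite mF; ring.
split.
  exists m, 0; split=> // -[/eqP]; rewrite mF mulf_eq0.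
  by rewrite (negPf S0) (negPf c1).
move=> u h u' h' t t'; apply: (mulfI c1).
have := L0 _ _ t; have := L0 _ _ t'; rewrite !multiplier_formE //.
move=> /eqP; rewrite subr_eq0 => /eqP e' /eqP; rewrite subr_eq0 => /eqP e.
by rewrite mulrCA e' [RHS]mulrA e; ring.
Qed.

(** At a pole omega is horizontal.  If omega = 0, both differentials vanish on
the tangent space.  Otherwise scaling omega changes E but not F2, while tilting
gamma towards omega changes F2, so the images of these two vectors are
independent. *)
Lemma rank_pole w g : dot g g = 1 -> dot w g = 0 -> 1 - g 0 2 ^+ 2 = 0 ->
  rank_dPhi 0 beta nu eta (row_mx w g) <> 1%N.
Proof.
move=> g1 wg c1; have [J0 Z0] := (Jsq_gt0 g1, Zsq_gt0 g1).
have S0 : Num.sqrt (Jsq g) != 0 by rewrite gt_eqF // sqrtr_gt0.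
rewrite (row3_eta w) (row3_eta g) in g1 wg c1 J0 Z0 S0 *.
move: (w 0 0) (w 0 1) (w 0 2) (g 0 0) (g 0 1) (g 0 2) g1 wg c1 J0 Z0 S0.
move=> p q r x y c; rewrite !dotE !row3E => g1 wg c1 J0 Z0 S0.
have xy : x ^+ 2 + y ^+ 2 = 0 by rewrite -[RHS]c1 -g1; ring.
have c0 : c != 0.
  by apply/eqP => c0; move/eqP: c1; rewrite c0 expr0n subr0 oner_eq0.
move/eqP: xy; rewrite paddr_eq0 ?sqr_ge0 // !sqrf_eq0 => /andP[/eqP x0 /eqP y0].
subst x y.
have r0 : r = 0.
  by apply: (mulIf c0); rewrite mul0r -wg; ring.
subst r.
move=> /rank_dPhiE [] // [u [h [[t1 t2] nz]]] par.
(* The coordinates are now omega = (p, q, 0) and gamma = (0, 0, c), c^2 = 1. *)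
have [pq|pq] := eqVneq (p ^+ 2 + q ^+ 2) 0.
  move/eqP: pq; rewrite paddr_eq0 ?sqr_ge0 // !sqrf_eq0 => /andP[/eqP p0 /eqP q0].
  subst p q; apply: nz; rewrite !dotE !row3E in t1 t2.
  have h2 : h 0 2 = 0 by apply: (mulfI c0); rewrite mulr0 -t1; ring.
  have u2 : u 0 2 = 0 by apply: (mulfI c0); rewrite mulr0 -t2; ring.
  have hZ : dZsq (row3 0 0 c) h = 0 by rewrite /dZsq dotE !row3E h2; ring.
  rewrite /dF2 /denergy hZ u2 row3E /dgram /dkin !dotE !row3E.
  by split; ring.
set w' := row3 p q 0 in par *; set g' := row3 0 0 c in par J0 Z0 S0 *.
pose n := p ^+ 2 + q ^+ 2.
have T1 : tangent w' g' w' 0 by rewrite /tangent !dotE !row3E !mxE; split; ring.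
have T2 : tangent w' g' (row3 0 0 (- (n / c))) w'.
  by rewrite /tangent !dotE !row3E; split; [ring | rewrite /n; field].
have := par _ _ _ _ T2 T1.
have -> : dF2 w' g' w' 0 = 0 by rewrite /dF2 /dJsq /dZsq dotE !row3E !mxE; ring.
have -> : dF2 w' g' (row3 0 0 (- (n / c))) w' = - (Num.sqrt (Jsq g') * n / c).
  by rewrite /dF2 !row3E; ring.
have -> : denergy w' g' w' 0 = (eta^-1 + c ^+ 2 / Zsq g') * n.
  have hZ : dZsq g' 0 = 0 by rewrite /dZsq dotE !mxE; ring.
  rewrite /denergy hZ /dgram /dkin !dotE !row3E !mxE !mulr0 !(addr0, subr0) /n.
  by move: (Zsq g')^-1 (eta^-1) => *; field.
rewrite mulr0 => /eqP; rewrite mulf_eq0 oppr_eq0 !mulf_eq0 invr_eq0.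
rewrite (negPf S0) (negPf c0) (negPf pq) !orbF /= gt_eqF //.
by apply: ltr_pwDl; rewrite ?invr_gt0 // divr_ge0 ?sqr_ge0 // ltW.
Qed.

Lemma horizontal_basis u (x y c : R) :
  x ^+ 2 + y ^+ 2 + c ^+ 2 = 1 -> 1 - c ^+ 2 != 0 ->
  dot u (row3 x y c) = 0 ->
  u = (u 0 2 / (1 - c ^+ 2)) *: merid x y c
      + ((x * u 0 1 - y * u 0 0) / (1 - c ^+ 2)) *: paral x y.
Proof.
move=> g1 c1; rewrite dotE !row3E => ug.
have hy : y ^+ 2 = 1 - x ^+ 2 - c ^+ 2 by rewrite -g1; ring.
have hu : u 0 1 * y = - (u 0 0 * x + u 0 2 * c) by rewrite -[RHS]addr0 -ug; ring.
have hu' : u 0 0 * x = - (u 0 1 * y + u 0 2 * c) by rewrite -[RHS]addr0 -ug; ring.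
have hx : x ^+ 2 = 1 - y ^+ 2 - c ^+ 2 by rewrite -g1; ring.
rewrite [LHS]row3_eta [RHS]row3_eta !mxE /=; congr row3.
- field: hu hy => //.
- field: hu' hx => //.
- by field.
Qed.

(** The multiplier form is evaluated on the frame (e3 x gamma, 0), (m, 0),
(- omega_3 gamma, m), (e3 x omega, e3 x gamma) of the tangent space. *)
Lemma critical_iff w g : dot g g = 1 -> dot w g = 0 ->
  rank_dPhi 0 beta nu eta (row_mx w g) = 1%N <->
  1 - g 0 2 ^+ 2 != 0 /\ exists t, w = t *: merid (g 0 0) (g 0 1) (g 0 2) /\
    (g 0 2 = 0 \/ t ^+ 2 * Jsq g * Num.sqrt (Zsq g) = beta ^+ 2 - 1).
Proof.
move=> g1 wg.
have [c1|c1] := eqVneq (1 - g 0 2 ^+ 2) 0.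
  by split=> [/(rank_pole g1 wg c1) | []].
rewrite rank_off_pole //.
have S0 : Num.sqrt (Zsq g) != 0 by rewrite gt_eqF // sqrtr_gt0 Zsq_gt0.
have gE := row3_eta g.
move: (g 0 0) (g 0 1) (g 0 2) gE c1 => x y c gE c1; subst g.
have g1' : x ^+ 2 + y ^+ 2 + c ^+ 2 = 1 by rewrite -g1 dotE !row3E; ring.
set g := row3 x y c in g1 wg S0 *; set m := merid x y c.
have gm : dot g m = 0.
  by rewrite dot_merid g1 row3E mulr1 subrr.
have gn : dot g (paral x y) = 0 by rewrite dotE !row3E; ring.
have T1 : tangent w g (paral x y) 0.
  by split=> //; rewrite !dot0r ?gn ?addr0.
have T2 : tangent w g m 0.
  by split=> //; rewrite !dot0r ?gm ?addr0.
have T3 : tangent w g (- w 0 2 *: g) m.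
  split=> //; rewrite dotZr g1 mulr1.
  by rewrite dot_merid wg mulr0 subr0 subrr.
have wE := horizontal_basis g1' c1 wg.
set t := w 0 2 / _ in wE; set k := (_ / _) in wE.
have Lp : multiplier_form w g (paral x y) 0 =
    (1 - c ^+ 2) ^+ 2 * (eta^-1 + dot (shape g) (shape g) / Zsq g) * k.
  by rewrite {1}wE multiplier_form_paral.
have A0 : eta^-1 + dot (shape g) (shape g) / Zsq g != 0.
  rewrite gt_eqF // ltr_pwDl ?invr_gt0 // divr_ge0 ?dot_ge0 //.
  exact/ltW/Zsq_gt0.
split=> [L0|[_ [t' [wt cond]]] u h [t1 t2]].
  split=> //; exists t.
  have k0 : k = 0.
    apply: (mulfI (mulf_neq0 (expf_neq0 2 c1) A0)).
    by rewrite -Lp (L0 _ _ T1) mulr0.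
  have wt : w = t *: m by rewrite wE k0 scale0r addr0.
  split=> //.
  have [->|c0] := eqVneq c 0; [by left | right].
  have := L0 _ _ T3; rewrite wt multiplier_form_merid_transport //.
  rewrite -[RHS](mulr0 (c * (1 - c ^+ 2) ^+ 2)).
  move=> /(mulfI (mulf_neq0 c0 (expf_neq0 2 c1))) e.
  transitivity (((1 - beta ^+ 2) / Num.sqrt (Zsq g) + t ^+ 2 * Jsq g)
    * Num.sqrt (Zsq g) + (beta ^+ 2 - 1)); first by field.
  by rewrite e mul0r add0r.
have k0 : k = 0.
  by rewrite /k wt !mxE /=; field.
have L1 : multiplier_form w g (paral x y) 0 = 0 by rewrite Lp k0 mulr0.
have L2 : multiplier_form w g m 0 = 0 by exact: multiplier_form_merid.
have L3 : multiplier_form w g (- w 0 2 *: g) m = 0.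
  rewrite wt multiplier_form_merid_transport //.
  case: cond => [->|cond]; first by rewrite !mul0r.
  suff -> : (1 - beta ^+ 2) / Num.sqrt (Zsq g) + t' ^+ 2 * Jsq g = 0.
    by rewrite mulr0.
  by apply: (mulIf S0); rewrite mul0r mulrDl cond divfK //; ring.
(* Decomposition of a tangent vector (u, h) in the frame: the coordinates a, b of
   h are those of the last two vectors; once these are subtracted, the rest u1 of
   u is orthogonal to gamma and has coordinates d, e in the first two. *)
have hE := horizontal_basis g1' c1 (etrans (dotC _ _) t1).
set a := h 0 2 / _ in hE; set b := (_ / _) in hE.
pose u1 := u - (a *: (- w 0 2 *: g) + b *: row3 (- w 0 1) (w 0 0) 0).
have u1g : dot u1 g = 0.
  have wh : dot w h = a * w 0 2 + b * dot w (paral x y).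
    by rewrite {1}hE dotDr !dotZr dot_merid wg mulr0 subr0.
  rewrite -t2 wh -[a * w 0 2]mulr1 -{1}g1.
  by rewrite /u1 !dotE !mxE /=; ring.
have u1E := horizontal_basis g1' c1 u1g.
set d := u1 0 2 / _ in u1E; set e := (_ / _) in u1E.
have -> : h = a *: m + (b *: paral x y + (d *: 0 + (e *: 0 + 0))).
  by rewrite !scaler0 !addr0.
have -> : u = a *: (- w 0 2 *: g) + (b *: row3 (- w 0 1) (w 0 0) 0 +
     (d *: m + (e *: paral x y + 0))).
  by rewrite addr0 -u1E /u1 addrA addrCA subrr addr0.
have L4 := multiplier_form_rotation w g; rewrite !row3E in L4.
rewrite !multiplier_formDZ L1 L2 L3 L4 !mulr0 !add0r.
have := multiplier_formDZ w g (-1) 0 0 0 0.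
by rewrite !scaler0 !addr0 mulN1r addNr.
Qed.

(** * The critical set in spherical coordinates *)

Lemma gamma_of_unit (theta phi : R) :
  dot (gamma_of theta phi) (gamma_of theta phi) = 1.
Proof.
rewrite dotE !row3E.
have := cos2Dsin2 theta; have := cos2Dsin2 phi.
move: (sin phi) (cos phi) (sin theta) (cos theta) => a b s c ab <-.
by transitivity (c ^+ 2 + s ^+ 2 * (b ^+ 2 + a ^+ 2)); [ring | rewrite ab mulr1].
Qed.

(** gamma x (e3 x gamma) = e3 - c gamma, and |e3 x gamma| = sin theta. *)
Lemma meridE (theta phi : R) : 0 < sin theta ->
  let g := gamma_of theta phi in
  (enorm (cross (e3 R) g))^-1 *: cross g (cross (e3 R) g) =
  (sin theta)^-1 *: merid (g 0 0) (g 0 1) (g 0 2).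
Proof.
move=> s0 g.
have -> : cross (e3 R) g = row3 (- g 0 1) (g 0 0) 0.
  by rewrite /cross /e3 !row3E; congr row3; ring.
congr (_^-1 *: _).
  rewrite /enorm dotE !row3E -[RHS](ger0_norm (ltW s0)) -sqrtr_sqr.
  congr Num.sqrt; have := cos2Dsin2 phi.
  move: (sin phi) (cos phi) (sin theta) => a b s ab.
  by transitivity (s ^+ 2 * (b ^+ 2 + a ^+ 2)); [ring | rewrite ab mulr1].
have := gamma_of_unit theta phi; rewrite -/g dotE; clearbody g => g1.
rewrite /cross !row3E /merid; congr row3; try ring.
by rewrite -[X in _ = X - _]g1; ring.
Qed.

Lemma Zsq_gamma_of (theta phi : R) :
  Num.sqrt (Zsq (gamma_of theta phi)) = Zfun beta theta.
Proof.
congr Num.sqrt; rewrite /Zsq !row3E; have := cos2Dsin2 phi.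
move: (sin phi) (cos phi) (sin theta) => a b s ab.
transitivity (beta ^+ 2 * (s ^+ 2 * (b ^+ 2 + a ^+ 2)) + cos theta ^+ 2).
  by ring.
by rewrite ab mulr1.
Qed.

(** The factor cos theta cancels, and the last factor of the denominator is
eta J^2. *)
Lemma omega0_sqE (theta phi : R) : sin theta != 0 -> cos theta != 0 ->
  let g := gamma_of theta phi in
  omega0_sq 0 beta nu eta theta =
  (beta ^+ 2 - 1) * sin theta ^+ 2 / (Jsq g * Num.sqrt (Zsq g)).
Proof.
move=> s0 c0 g.
have g1 := gamma_of_unit theta phi.
have J0 : Jsq g != 0 by rewrite gt_eqF // Jsq_gt0.
have Z0 : Zfun beta theta != 0.
  by rewrite -(Zsq_gamma_of _ phi) gt_eqF // sqrtr_gt0 Zsq_gt0.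
have ez : eta != 0 by rewrite gt_eqF.
have JE : eta * Jsq g =
    eta * Zfun beta theta ^+ 2 + cos theta ^+ 2 + nu * sin theta ^+ 2.
  rewrite -(Zsq_gamma_of _ phi) sqr_sqrtr ?Zsq_ge0 // /Jsq row3E sin2cos2; field.
  by [].
rewrite Zsq_gamma_of /omega0_sq !mul0r !addr0 -JE.
by field; rewrite Z0 c0 J0 ez.
Qed.

End Ellipsoid.

Theorem mainTheorem6 (R : realType) (alpha beta nu eta : R)
    (halpha : alpha = 0) (hbeta : 0 < beta) (hnu : 0 < nu <= 2)
    (heta : 0 < eta) :
  S1 alpha beta nu eta = S1_alpha alpha beta nu eta `|` S1_0 R.
Proof.
subst alpha; have {hnu} nu0 : 0 < nu by case/andP: hnu.
apply/seteqP; split=> z.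
  rewrite -(hsubmxK z); move: (lsubmx z) (rsubmx z) => w g [].
  rewrite /M4 /= /F0 /F1 omega_row_mx gamma_row_mx => -[g1 wg].
  move/(critical_iff hbeta nu0 heta g1 wg) => [c1 [t [wE cond]]].
  have [|theta [phi [th ph gE]]] := @spherical R (g 0 0) (g 0 1) (g 0 2) _ c1.
    by rewrite -g1 dotE; ring.
  rewrite -row3_eta in gE; subst g.
  have s0 : 0 < sin theta by exact: sin_gt0_pi.
  have sn : sin theta != 0 by rewrite gt_eqF.
  have gc : gamma_of theta phi 0 2 = cos theta by rewrite row3E.
  have [c0|c0] := eqVneq (cos theta) 0.
    right; exists t, (pi / 2), phi.
    have thE := cos_eq0_pihalf th c0.
    split=> //; rewrite -thE wE gc c0.
    congr row_mx; rewrite /merid row3Z; congr row3; ring.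
  left; exists theta, phi, (t * sin theta).
  case: cond => [|cond]; first by rewrite gc => /eqP; rewrite (negPf c0).
  have oE : (t * sin theta) ^+ 2 = omega0_sq 0 beta nu eta theta.
    rewrite (omega0_sqE hbeta nu0 heta phi sn c0) -cond.
    by field; rewrite !gt_eqF ?sqrtr_gt0 ?Jsq_gt0 ?Zsq_gt0.
  split=> //.
  - by split=> // thE; move: c0; rewrite thE cos_pihalf eqxx.
  - by rewrite -oE sqr_ge0.
  - by rewrite /= meridE // scalerA mulfK ?gt_eqF // -wE.
case=> [z_alpha | [omg [theta [phi [thE ph ->]]]]].
  case: z_alpha => theta [phi [omg [thn ph o0 oE ->]]]; case: thn => th thn.
  have s0 : 0 < sin theta by exact: sin_gt0_pi.
  have sn : sin theta != 0 by rewrite gt_eqF.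
  have c0 : cos theta != 0 by apply/eqP => /(cos_eq0_pihalf th).
  rewrite /= meridE // scalerA; move: (gamma_of_unit theta phi) oE.
  rewrite (omega0_sqE hbeta nu0 heta phi sn c0).
  set g := gamma_of theta phi => g1 oE.
  have gc : g 0 2 = cos theta by rewrite row3E.
  have wg : dot ((omg / sin theta) *: merid (g 0 0) (g 0 1) (g 0 2)) g = 0.
    by rewrite dotZl dotC dot_merid -row3_eta g1 mulr1 subrr mulr0.
  split; first by rewrite /M4 /= /F0 /F1 omega_row_mx gamma_row_mx.
  apply/(critical_iff hbeta nu0 heta g1 wg); split.
    by rewrite gc -sin2cos2 expf_neq0 // gt_eqF.
  exists (omg / sin theta); split=> //; right; rewrite expr_div_n oE.
  by field; rewrite !gt_eqF ?sqrtr_gt0 ?Jsq_gt0 ?Zsq_gt0.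
rewrite thE; move: (gamma_of_unit (pi / 2) phi).
set g := gamma_of (pi / 2) phi => g1.
have gc : g 0 2 = 0 by rewrite row3E cos_pihalf.
have wg : dot (row3 0 0 omg) g = 0 by rewrite dotE gc !row3E; ring.
split; first by rewrite /M4 /= /F0 /F1 omega_row_mx gamma_row_mx.
apply/(critical_iff hbeta nu0 heta g1 wg); split.
  by rewrite gc expr0n subr0 oner_eq0.
exists omg; split; last by left.
by rewrite gc /merid row3Z; congr row3; ring.
Qed.
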